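(* Let $k\ge1$, $S=\{1,\dots,k\}$, and for each $i\in S$ let $D_i=\{A\subseteq S\mid i\in A\}$ and let $s_i\in\mathcal{P}(\wp(S),S)$ be the constant function with domain $D_i$ and value $i$. Then for every $p\in S$ and every choice function $\gamma$ with domain $D_p$ (that is, $\gamma:D_p\to S$ with $\gamma(A)\in A$ for all $A\in D_p$), there is a term $t(x_1,\dots,x_k)$ built from the variables using only the binary operation $\underline{\phantom{a}}[\underline{\phantom{a}}]$ such that $t(s_1,\dots,s_k)=\gamma$, where $t$ is evaluated in $\mathcal{P}(\wp(S),S)$ with update.
   Context: $\mathcal{P}(X,Y)$ is the set of partial functions from $X$ to $Y$; $\wp(S)$ is the powerset of $S$. Override: $(f\sqcup g)(x)=f(x)$ if $x\in\mathrm{dom}(f)$, $=g(x)$ if $x\in\mathrm{dom}(g)\setminus\mathrm{dom}(f)$, undefined otherwise. Update: $f[g]$ is the restriction of $g\sqcup f$ to $\mathrm{dom}(f)$ (i.e. $f[g](x)=g(x)$ if $x\in\mathrm{dom}(f)\cap\mathrm{dom}(g)$, $f(x)$ if $x\in\mathrm{dom}(f)\setminus\mathrm{dom}(g)$, undefined otherwise). (The functions $s_1,\dots,s_k$ are the canonical representation of the free generators of the free algebra of $\operatorname{Rep}(\{\underline{\phantom{a}}[\underline{\phantom{a}}]\})$.) *)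

(* Defs.v *)
From mathcomp Require Import all_boot.

Set Implicit Arguments.
Unset Strict Implicit.
Unset Printing Implicit Defensive.

(* P(X, Y): [f x = None] means that [f] is undefined at [x]. *)
Definition pfun (X Y : Type) : Type := X -> option Y.

Definition dom (X Y : Type) (f : pfun X Y) : pred X := fun x => isSome (f x).

Definition restrict (X Y : Type) (D : {pred X}) (f : pfun X Y) : pfun X Y :=
  fun x => if x \in D then f x else None.

(* When both arguments are defined, the left one takes precedence. *)
Definition override (X Y : Type) (f g : pfun X Y) : pfun X Y :=
  fun x => if f x is Some y then Some y else g x.

(* f[g] *)
Definition update (X Y : Type) (f g : pfun X Y) : pfun X Y :=
  restrict (dom f) (override g f).

Definition const_pfun (X Y : Type) (D : {pred X}) (y : Y) : pfun X Y :=
  restrict D (fun _ => Some y).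

(* Terms in the variables x_i, i : 'I_k, over the single binary operation
   _[_]; [Upd t u] is t[u]. *)
Inductive term (k : nat) : Type :=
  | Var of 'I_k
  | Upd of term k & term k.

Fixpoint eval (k : nat) (X Y : Type) (v : 'I_k -> pfun X Y) (t : term k) :
    pfun X Y :=
  match t with
  | Var i => v i
  | Upd t1 t2 => update (eval v t1) (eval v t2)
  end.

(* S = {1, ..., k} is represented by 'I_k = {0, ..., k - 1}. *)
Definition D (k : nat) (i : 'I_k) : {set {set 'I_k}} :=
  [set A : {set 'I_k} | i \in A].

Definition s (k : nat) (i : 'I_k) : pfun {set 'I_k} 'I_k :=
  const_pfun (D i) i.

Definition choice_function_on (T : finType) (E : {set {set T}})
    (g : pfun {set T} T) : Prop :=
  dom g =i E /\ (forall (A : {set T}) (a : T), g A = Some a -> a \in A).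

(* Main.v *)
(** On functions with domain [D p], the term operation [f[s_q[g]]] is the test
    "if [q \in A] then [g A] else [f A]".  Nesting these tests over all [q]
    gives a decision tree that identifies [A] completely, and at the leaf [A]
    the function [s_p[s_a]] takes the prescribed value [a = gamma A]. *)
Require Import Defs.
From mathcomp Require Import all_boot.
From Stdlib Require Import FunctionalExtensionality.

Lemma in_dom (X Y : Type) (f : pfun X Y) (x : X) : (x \in dom f) = f x.
Proof. by []. Qed.

Lemma updateE (X Y : Type) (f g : pfun X Y) (x : X) :
  update f g x =
  if f x is Some y then (if g x is Some z then Some z else Some y) else None.
Proof.
by rewrite /update /restrict /override in_dom; case: (f x); case: (g x).
Qed.

Lemma sE (k : nat) (i : 'I_k) (A : {set 'I_k}) :
  s i A = if i \in A then Some i else None.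
Proof. by rewrite /s /const_pfun /restrict inE. Qed.

(** Outside [D p] the inner update may still return the default [q], but there [f] is undefined and
    the outer update discards it. *)
Lemma update_testE {k : nat} {p q : 'I_k} {f g : pfun {set 'I_k} 'I_k} :
  dom f =i D p -> dom g =i D p ->
  forall A : {set 'I_k},
    update f (update (s q) g) A = if q \in A then g A else f A.
Proof.
move=> domf domg A; have := domf A; have := domg A.
rewrite !updateE sE !inE !in_dom => <-.
by case: (f A); case: (g A); case: (q \in A).
Qed.

(** Induction on [l], the elements still to be tested; outside [l], [B] records the answers already
    obtained. The domain is carried along because [update_testE] needs it for both branches. *)
Lemma decision_tree {k : nat} {p : 'I_k} {gamma : pfun {set 'I_k} 'I_k}
    (hgamma : choice_function_on (D p) gamma) (l : seq 'I_k) (B : {set 'I_k}) :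
  exists2 t : term k, dom (eval (@s k) t) =i D p &
    forall A : {set 'I_k}, p \in A ->
      (forall q, q \notin l -> (q \in A) = (q \in B)) ->
      eval (@s k) t A = gamma A.
Proof.
have [domg choice] := hgamma.
elim: l B => [|q l IHl] B.
  case gB: (gamma B) => [a|].
    (* The choice property gives [a \in B], so [s a] is defined at [B] and overrides the value
       [p]. *)
    exists (Upd (Var p) (Var a)) => [A|A pA eqAB] /=.
      by rewrite inE in_dom updateE !sE; case: (p \in A); case: (a \in A).
    have eAB : A = B by apply/setP=> q; apply: eqAB.
    by rewrite updateE !sE pA eAB (choice _ _ gB) gB.
  (* Here [p \notin B], so no [A] reaches this leaf; any term with domain [D p] will do. *)
  exists (Var p) => [A|A pA eqAB] /=.
    by rewrite inE in_dom sE; case: (p \in A).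
  have eAB : A = B by apply/setP=> q; apply: eqAB.
  by have := domg B; rewrite inE in_dom gB -eAB pA.
(* The two subtrees record the answers [q \in A] and [q \notin A]. *)
have [t1 dom1 eval1] := IHl (q |: B).
have [t0 dom0 eval0] := IHl (B :\ q).
exists (Upd t0 (Upd (Var q) t1)) => [A|A pA eqAB] /=.
  have := dom0 A; have := dom1 A; rewrite !in_dom (update_testE dom0 dom1).
  by case: (q \in A).
rewrite (update_testE dom0 dom1); case: ifPn => qA; [apply: eval1|apply: eval0] => // r rl;
  rewrite !inE; case: (eqVneq r q) => [->|rq] /=; rewrite ?qA ?(negPf qA) //;
  by apply: eqAB; rewrite inE negb_or rq.
Qed.

Theorem theorem6p1 (k : nat) (hk : 1 <= k) (p : 'I_k)
    (gamma : pfun {set 'I_k} 'I_k) (hgamma : choice_function_on (D p) gamma) :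
  exists t : term k, eval (@s k) t = gamma.
Proof.
(* Every element is still to be tested, so the choice of [set0] is immaterial. *)
have [t domt evalt] := decision_tree hgamma (enum 'I_k) set0.
exists t; apply: functional_extensionality => A.
have [pA|pA] := boolP (p \in A).
  by apply: evalt => // q; rewrite mem_enum.
have [domg _] := hgamma; move: (domt A) (domg A).
by rewrite inE (negPf pA) !in_dom; case: (eval _ t A); case: (gamma A).
Qed.
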